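(* Let $k\ge 0$, $m,m'$ be integers with $m\ge 2m'$, $m\geq k(k+1)$, $m'\geq (k+1)^2$, and consider the dual pair $(\mathrm{Sp}_{2m}(q),\mathrm{O}^{\epsilon}_{2m'}(q))$ with $\epsilon=+$ if $k$ is odd and $\epsilon=-$ if $k$ is even. Put $l=m-k(k+1)$ and $l'=m'-(k+1)^2$, and let $\Omega_{l,l'}$ be the representation of $W_l\times W_{l'}$ given by $$\Omega_{l,l'}=\sum_{r=0}^{\min(l,l')}\ \sum_{(\xi,\eta)\in\mathscr{P}_2(r)}\ \sum_{\xi',\eta'}\chi_{\xi',\eta}\otimes\chi_{\xi,\eta'},$$ where the third sum is over partitions $\xi'$ of $l-|\eta|$ and $\eta'$ of $l'-|\xi|$ such that $\xi\preceq\xi'$ and $\eta\preceq\eta'$. Let $(\xi',\eta')$ be a bipartition of $l'$, with $\xi'=(\xi'_1,\ldots,\xi'_r)$ and $\eta'=(\eta'_1,\ldots,\eta'_r)$ (adding zeros if necessary), and let $\Theta(\xi',\eta')$ be the set of bipartitions $(\xi,\eta)$ of $l$ such that $\chi_{\xi,\eta}\otimes\chi_{\xi',\eta'}$ is an irreducible component of $\Omega_{l,l'}$. Then: 1. There exists a unique minimal representation in $\Theta(\xi',\eta')$; it corresponds to the bipartition $((l-l')\cup\xi',\eta')$. 2. There exists a unique maximal representation in $\Theta(\xi',\eta')$; it is the bipartition $((l-l'+\eta'_1+\xi'_1,\xi'_2,\ldots,\xi'_r),(\eta'_2,\ldots,\eta'_r))$.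
   Context: Partitions $\mu=(\mu_1\ge\mu_2\ge\cdots)$ are identified up to trailing zeros; $|\mu|$ is the sum of the parts; $a\cup\mu$ is the partition obtained by adjoining the part $a$ to $\mu$. For partitions of possibly different integers, $\mu\preceq\mu'$ means $\mu'_{i+1}\le\mu_i\le\mu'_i$ for all $i$. For partitions of the same integer, $\mu\le\mu'$ means $\mu_1+\cdots+\mu_j\le\mu'_1+\cdots+\mu'_j$ for all $j$. $\mathscr{P}_2(n)$ is the set of bipartitions $(\lambda,\mu)$ of $n$ (pairs of partitions with $|\lambda|+|\mu|=n$). $W_n$ is the Weyl group of type $B_n$ (equivalently $C_n$), and $\chi_{\lambda,\mu}$ is its irreducible representation indexed by $(\lambda,\mu)\in\mathscr{P}_2(n)$. The representation $\Omega_{l,l'}$ describes the Howe correspondence between the unipotent Harish-Chandra series of the pair attached to the cuspidal unipotent representation with parameter $k$ of a symplectic group; the condition $m\ge 2m'$ is the stable range condition. The map $\lambda(\cdot,\cdot)$ from bipartitions of $n$ to symplectic partitions of $2n$ (partitions in which each odd part has even multiplicity; they parametrize unipotent classes of $\mathrm{Sp}_{2n}(\overline{\mathbb{F}}_q)$) is defined as follows. (a) Let $\lambda$ be a symplectic partition of $2n$, written with an even number $2j$ of parts (adding a zero if necessary). Put $\lambda^*_i=\lambda_{2j-i+1}+i-1$ for $i=1,\ldots,2j$. Among the $\lambda_i^*$ there are $j$ odd numbers $2\xi^*_1+1<\cdots<2\xi^*_j+1$ and $j$ even numbers $2\eta^*_1<\cdots<2\eta^*_j$. Put $\xi_i=\xi^*_{j-i+1}-(j-i)$,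 $\eta_i=\eta^*_{j-i+1}-(j-i)$. This defines a bipartition $(\xi(\lambda),\eta(\lambda))$ of $n$, and the map $\lambda\mapsto(\xi(\lambda),\eta(\lambda))$ is injective. (b) To a bipartition $(\xi,\eta)$ of $n$, written (adding zeros) so that $\eta$ has $j$ parts and $\xi$ has $j+1$ parts, one associates the $u$-symbol with top row $\xi_{j+1},\xi_j+2,\ldots,\xi_1+2j$ and bottom row $\eta_j+1,\eta_{j-1}+3,\ldots,\eta_1+2j-1$. It is distinguished if $\xi_{j+1}\le\eta_j+1\le\xi_j+2\le\eta_{j-1}+3\le\cdots\le\xi_1+2j$. Two $u$-symbols are similar if they have the same entries with the same multiplicities; each similarity class contains exactly one distinguished $u$-symbol. A bipartition is in the image of the map in (a) if and only if its $u$-symbol is distinguished. (c) For any bipartition $(\xi,\eta)$ of $n$, $\lambda(\xi,\eta)$ is the symplectic partition $\lambda$ such that $(\xi(\lambda),\eta(\lambda))$ is the bipartition whose $u$-symbol is the distinguished one similar to the $u$-symbol of $(\xi,\eta)$. (Via the Springer correspondence, $\chi_{\xi,\eta}$ is attached to the unipotent class parametrized by $\lambda(\xi,\eta)$.) A minimal representation in $\Theta(\xi',\eta')$ is an element $(\xi_{\min},\eta_{\min})\in\Theta(\xi',\eta')$ with $\lambda(\xi_{\min},\eta_{\min})\le\lambda(\xi,\eta)$ for all $(\xi,\eta)\in\Theta(\xi',\eta')$; a maximal representation is an element $(\xi_{\max},\eta_{\max})\in\Theta(\xi',\eta')$ with $\lambda(\xi,\eta)\le\lambda(\xi_{\max},\eta_{\max})$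 for all $(\xi,\eta)\in\Theta(\xi',\eta')$. *)

(* Defs.v *)
From HB Require Import structures.
From mathcomp Require Import all_boot all_order all_algebra.
From mathcomp Require Import all_fingroup all_solvable all_field all_character.

Set Implicit Arguments.
Unset Strict Implicit.
Unset Printing Implicit Defensive.

Local Open Scope nat_scope.

(* A partition is the list of its nonzero parts, so that partitions differing *)
(* by trailing zeros are literally equal; the i-th part (from 0) of mu is     *)
(* nth 0 mu i, which is 0 beyond the length.                                  *)
Definition is_part (s : seq nat) : bool := sorted geq s && (0 \notin s).

Definition nz (s : seq nat) : seq nat := [seq a <- s | 0 < a].

Definition is_intpart (n : nat) (s : seq nat) : bool :=
  is_part s && (sumn s == n).

Definition is_bipart (n : nat) (x : seq nat * seq nat) : bool :=
  [&& is_part x.1, is_part x.2 & sumn x.1 + sumn x.2 == n].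

Record intpart (n : nat) : predArgType :=
  IntPart { ipval :> seq nat; _ : is_intpart n ipval }.

Record bipart (n : nat) : predArgType :=
  BiPart { bpval :> seq nat * seq nat; _ : is_bipart n bpval }.

(* The finite type structures on intpart n and bipart n come from the fact    *)
(* that a partition of size at most n has at most n parts, all at most n.     *)
Definition part_enc (n : nat) (s : seq nat) : {bseq n of 'I_n.+1} :=
  insub_bseq n (map inord s).

Definition part_dec (n : nat) (b : {bseq n of 'I_n.+1}) : seq nat :=
  map val b.

Lemma part_encK n s : is_part s -> sumn s <= n -> part_dec (part_enc n s) = s.
Proof.
case/andP=> _ s0 le_sn.
have le_size: size s <= n.
  apply: leq_trans le_sn; elim: s s0 => //= a s IHs.
  rewrite inE negb_or eq_sym -lt0n => /andP[a_gt0 /IHs].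
  by move=> le_s; rewrite -add1n leq_add.
have le_part a : a \in s -> a <= n.
  move=> s_a; apply: leq_trans le_sn; elim: s {s0 le_size} s_a => //= b s IHs.
  by rewrite inE => /predU1P[-> | /IHs/leq_trans-> //]; rewrite ?leq_addr ?leq_addl.
rewrite /part_dec /part_enc /insub_bseq insubdK ?unfold_in /= ?size_map //.
by rewrite -map_comp map_id_in // => a /le_part le_an /=; rewrite inordK.
Qed.

HB.instance Definition _ n := [isSub for @ipval n].
HB.instance Definition _ n := [Countable of intpart n by <:].

Fact intpart_pcan n :
  pcancel (fun x : intpart n => part_enc n x)
          (fun b => insub (part_dec b) : option (intpart n)).
Proof.
move=> x; have /andP[x_part /eqP size_x] := valP x.
by rewrite part_encK ?size_x // valK.
Qed.
HB.instance Definition _ n : isFinite (intpart n) :=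
  PCanIsFinite (@intpart_pcan n).

HB.instance Definition _ n := [isSub for @bpval n].
HB.instance Definition _ n := [Countable of bipart n by <:].

Fact bipart_pcan n :
  pcancel (fun x : bipart n => (part_enc n x.1, part_enc n x.2))
          (fun b => insub (part_dec b.1, part_dec b.2) : option (bipart n)).
Proof.
move=> x; have /and3P[x1_part x2_part /eqP size_x] := valP x.
rewrite /= !part_encK -?{2}size_x ?leq_addr ?leq_addl //.
by rewrite -surjective_pairing valK.
Qed.
HB.instance Definition _ n : isFinite (bipart n) :=
  PCanIsFinite (@bipart_pcan n).

Definition adjoin_part (a : nat) (mu : seq nat) : seq nat :=
  nz (sort geq (a :: mu)).

(* mu'_(i+1) <= mu_i <= mu'_i for all i: past the two lengths all three terms *)
(* are 0, so the bounded range loses nothing.                                 *)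
Definition interlaced (mu mu' : seq nat) : bool :=
  all (fun i => nth 0 mu' i.+1 <= nth 0 mu i <= nth 0 mu' i)
      (iota 0 (maxn (size mu) (size mu'))).

(* Only used for partitions of the same integer. *)
Definition dominated (mu mu' : seq nat) : Prop :=
  forall j, sumn (take j mu) <= sumn (take j mu').

Definition symplectic_part (la : seq nat) : bool :=
  all (fun a => odd a ==> ~~ odd (count_mem a la)) la.

(* The bipartition (xi(la), eta(la)): la is padded to 2j = size la or         *)
(* (size la).+1 parts. For symplectic la both classes of parity in la_star    *)
(* have j elements, and since la_star is strictly increasing the truncated    *)
(* subtractions in unstep are exact.                                          *)
Definition la_star (la : seq nat) : seq nat :=
  let j := uphalf (size la) in
  mkseq (fun i => nth 0 la (j.*2 - i.+1) + i) j.*2.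

Definition unstep (j : nat) (s : seq nat) : seq nat :=
  nz (mkseq (fun i => nth 0 s (j - i.+1) - (j - i.+1)) j).

Definition springer_bipart (la : seq nat) : seq nat * seq nat :=
  let j := uphalf (size la) in
  (unstep j [seq a./2 | a <- la_star la & odd a],
   unstep j [seq a./2 | a <- la_star la & ~~ odd a]).

(* The u-symbol of x = (xi, eta), with j+1 entries for xi and j for eta. *)
Definition usymbol (j : nat) (x : seq nat * seq nat) : seq nat * seq nat :=
  (mkseq (fun i => nth 0 x.1 (j - i) + i.*2) j.+1,
   mkseq (fun i => nth 0 x.2 (j - i.+1) + i.*2.+1) j).

Definition distinguished_symbol (u : seq nat * seq nat) : bool :=
  all (fun i => nth 0 u.1 i <= nth 0 u.2 i <= nth 0 u.1 i.+1)
      (iota 0 (size u.2)).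

Definition similar_symbols (u v : seq nat * seq nat) : bool :=
  perm_eq (u.1 ++ u.2) (v.1 ++ v.2).

(* The symplectic partition lambda(xi, eta) of 2n. Every bipartition of n can *)
(* be written with j = n, and similarity and distinguishedness do not depend  *)
(* on the common choice of j. There is exactly one la satisfying the          *)
(* condition when x is a bipartition of n, so the value [::] is never taken   *)
(* as a default.                                                              *)
Definition springer_part (n : nat) (x : seq nat * seq nat) : seq nat :=
  if [pick la : intpart n.*2 |
        [&& symplectic_part la,
            distinguished_symbol (usymbol n (springer_bipart la)) &
            similar_symbols (usymbol n x) (usymbol n (springer_bipart la))]]
  is Some la then ipval la else [::].

Definition sign_flip_fun (n : nat) (x : 'I_n * bool) : 'I_n * bool :=
  (x.1, ~~ x.2).

Fact sign_flip_inj n : injective (@sign_flip_fun n).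
Proof. by case=> [i a] [j b] [-> /negb_inj->]. Qed.

(* The Weyl group of type B_n, as the group of signed permutations: the       *)
(* permutations of {1, .., n, -1, .., -n} that commute with negation.         *)
Definition sign_flip (n : nat) : {perm 'I_n * bool} := perm (@sign_flip_inj n).

Definition weylB (n : nat) : {group {perm 'I_n * bool}} := 'C[sign_flip n]%G.

Section OuterTensor.

Import GRing.Theory.
Local Open Scope ring_scope.

Variables (gT1 gT2 : finGroupType) (G1 : {group gT1}) (G2 : {group gT2}).
Variables (phi1 : 'CF(G1)) (phi2 : 'CF(G2)).

Fact cf_outer_subproof :
  is_class_fun <<setX G1 G2>>%g [ffun x => phi1 x.1 * phi2 x.2].
Proof.
rewrite genGid; apply: intro_class_fun => [[x1 x2] [y1 y2] | [x1 x2]].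
  rewrite !inE /= => /andP[Gx1 Gx2] /andP[Gy1 Gy2].
  by rewrite -(cfunJ phi1 x1 Gy1) -(cfunJ phi2 x2 Gy2).
rewrite !inE negb_and /= => /orP[] notGx.
  by rewrite (cfun0 phi1) ?mul0r.
by rewrite (cfun0 phi2) ?mulr0.
Qed.

(* The external tensor product, (x1, x2) |-> phi1 x1 * phi2 x2. *)
Definition cf_outer : 'CF(setX G1 G2) := Cfun 0 cf_outer_subproof.

End OuterTensor.

(* An indexing of the irreducible characters of each W_n by bipartitions of   *)
(* n; the values of chi n outside of bipartitions of n are irrelevant.        *)
Definition indexes_irr (chi : forall n, seq nat * seq nat -> Iirr (weylB n)) :
    Prop :=
  forall n, bijective (fun x : bipart n => chi n (bpval x)).

Section Howe.

Local Open Scope ring_scope.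

Variable chi : forall n, seq nat * seq nat -> Iirr (weylB n).

Definition chi_tensor (l l' : nat) (x x' : seq nat * seq nat) :
    'CF(setX (weylB l) (weylB l')) :=
  cf_outer 'chi_(chi l x) 'chi_(chi l' x').

(* In the inner sums xi = x.1 and eta = x.2; since r <= l, l', the            *)
(* subtractions l - |eta| and l' - |xi| are exact.                            *)
Definition Omega (l l' : nat) : 'CF(setX (weylB l) (weylB l')) :=
  \sum_(r < (minn l l').+1) \sum_(x : bipart r)
    \sum_(xi' : intpart (l - sumn x.2)%N | interlaced x.1 xi')
    \sum_(eta' : intpart (l' - sumn x.1)%N | interlaced x.2 eta')
      chi_tensor l l' (ipval xi', x.2) (x.1, ipval eta').

Definition Theta (l l' : nat) (x' : seq nat * seq nat) : {set bipart l} :=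
  [set x : bipart l |
    [exists i in irr_constt (Omega l l'), 'chi_i == chi_tensor l l' x x']].

End Howe.

Definition minimal_rep (l : nat) (T : {set bipart l}) (x : bipart l) : Prop :=
  x \in T /\
  forall y, y \in T -> dominated (springer_part l x) (springer_part l y).

Definition maximal_rep (l : nat) (T : {set bipart l}) (x : bipart l) : Prop :=
  x \in T /\
  forall y, y \in T -> dominated (springer_part l y) (springer_part l x).

(* Main.v *)
Require Import Defs.
From mathcomp Require Import all_boot all_order all_algebra.
From mathcomp Require Import all_fingroup all_solvable all_field all_character.
From mathcomp Require Import zify.

(** External products of irreducible characters are distinct irreducible
    characters, so [Theta] is read off the terms of [Omega]: it consists of the
    bipartitions (a, b) of l with c <= a and b <= d in the interlacing order,
    where (c, d) is the given bipartition of l' ([mem_Theta]). Interlacing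
    leaves every part but a_1 bounded on both sides:
      c_(i+1) <= a_(i+1) <= c_i   and   d_(i+1) <= b_i <= d_i,
    and a_1 is then determined by the size. At one extreme all these bounds are
    attained from above, which gives ((l - l') :: c, d); at the other they are
    attained from below, which gives the proposed maximal bipartition.
    The hypotheses on k, m and m' give l' < l - l', which makes both of these
    members of [Theta] and makes a_1 larger than every b_i. So the theorem
    reduces to this: moving boxes into the first part of the first partition
    raises the symplectic partition ([shifted_dominated]), strictly if
    something moves ([shifted_eq]).

    Domination of symplectic partitions is translated to u-symbols. Let L_i be
    the partial sums of a symplectic partition, and let e_i be the differences
    of the halves (rounded down) of consecutive L_i ([halves]). The bipartition
    attached to the partition has the e_i with i even as its first component
    and those with i odd as its second ([nth_springer_bipart]), and the
    decreasing list of the entries of its u-symbol is e_i + 2n - i, i = 0..2n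
    ([entries_springer_bipart]). Hence the half of L_i is, up to a constant
    depending on i and n, the sum of the i largest entries of the u-symbol, and
    it depends only on the similarity class. Parity costs nothing: L_i is odd
    exactly when the u-symbol has a tie at that place, and domination of
    u-symbols forces ties upwards ([psum_le_halves]).

    The sum of the i largest entries of a u-symbol is the maximum, over
    p + q = i, of the sum of the p largest entries of the first row and the q
    largest of the second ([merge_psum_eq], [merge_psum_ge]). When the first row
    contains the largest entry one may take p > 0, and then such a sum is the
    total size minus the parts left out, none of which is a_1: lowering these
    parts raises the sum. The largest entry is a_1 + 2n, so equality at i = 1
    already fixes a_1, hence the size of the rest, hence everything. *)

Set Implicit Arguments.
Unset Strict Implicit.
Unset Printing Implicit Defensive.

(** * External products of characters *)

Section OuterProducts.
Import GRing.Theory Num.Theory.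
Local Open Scope ring_scope.

Lemma cfdot_cf_outer (gT1 gT2 : finGroupType)
    (G1 : {group gT1}) (G2 : {group gT2})
    (phi1 psi1 : 'CF(G1)) (phi2 psi2 : 'CF(G2)) :
  '[cf_outer phi1 phi2, cf_outer psi1 psi2] = '[phi1, psi1] * '[phi2, psi2].
Proof.
rewrite !cfdotE mulrACA cardsX natrM invfM; congr (_ * _).
rewrite big_distrlr pair_big_dep /=; apply: eq_big => [[x y]|[x y] _].
  by rewrite !inE.
by rewrite !cfunE /= rmorphM mulrACA.
Qed.

(** [cfMorph] wants its argument on the group [f @* G] itself; this form allows
    a group that is only provably equal to it. *)
Lemma cf_pullback_char (aT rT : finGroupType) (G D : {group aT})
    (f : {morphism D >-> rT}) (H : {group rT}) (phi : 'CF(H)) :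
  G \subset D -> (f @* G = H)%g -> phi \is a character ->
  exists2 psi : 'CF(G), psi \is a character
    & {in G, forall x, psi x = phi (f x)}.
Proof.
move=> sGD fGH; have eqH : H = (f @* G)%G by apply: group_inj.
rewrite {}eqH {fGH} in phi *.
by exists (cfMorph phi) => [|x Gx]; rewrite ?cfMorph_char ?cfMorphE.
Qed.

(** The external product is the product of the pullbacks along the two
    projections. *)
Lemma cf_outer_char (gT1 gT2 : finGroupType)
    (G1 : {group gT1}) (G2 : {group gT2}) (phi1 : 'CF(G1)) (phi2 : 'CF(G2)) :
  phi1 \is a character -> phi2 \is a character ->
  cf_outer phi1 phi2 \is a character.
Proof.
move=> /(cf_pullback_char (subsetT _) (morphim_fstX G1 G2))[psi1 psi1_char eq1].
move=> /(cf_pullback_char (subsetT _) (morphim_sndX G1 G2))[psi2 psi2_char eq2].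
rewrite (_ : cf_outer _ _ = psi1 * psi2) ?rpredM //.
by apply/cfun_inP=> x Gx; rewrite !cfunE eq1 ?eq2.
Qed.

Lemma cf_outer_irr (gT1 gT2 : finGroupType)
    (G1 : {group gT1}) (G2 : {group gT2}) (i : Iirr G1) (j : Iirr G2) :
  cf_outer 'chi_i 'chi_j \in irr (setX_group G1 G2).
Proof.
rewrite irrEchar cf_outer_char ?irr_char //=.
by rewrite cfdot_cf_outer !cfnorm_irr mulr1.
Qed.

(** Multiplicities are natural numbers, so nothing cancels in a sum of
    characters. *)
Lemma irr_constt_sum (gT : finGroupType) (G : {group gT}) (I : finType)
    (P : pred I) (F : I -> 'CF(G)) (i0 : I) (t : Iirr G) :
    (forall i, P i -> F i \is a character) -> P i0 ->
  t \in irr_constt (F i0) -> t \in irr_constt (\sum_(i | P i) F i).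
Proof.
move=> Fchar Pi0; rewrite (bigD1 i0) //= !irr_consttE cfdotDl.
have /natrP[n ->] := Cnat_cfdot_char_irr t (Fchar _ Pi0).
have /(Cnat_cfdot_char_irr t)/natrP[m ->] :
    (\sum_(i | P i && (i != i0)) F i) \is a character.
  by apply: rpred_sum => i /andP[/Fchar].
by rewrite -natrD !pnatr_eq0 addn_eq0 negb_and => ->.
Qed.

End OuterProducts.

(** * Partitions as lists *)

Lemma geq_trans : transitive geq.
Proof. by move=> a b c ba ac; apply: leq_trans ac ba. Qed.

Lemma sorted_geq_nthS s i : sorted geq s -> nth 0 s i.+1 <= nth 0 s i.
Proof.
move=> s_sorted; have [lt_is|le_si] := ltnP i.+1 (size s); last first.
  by rewrite (nth_default _ le_si).
by apply: (sorted_ltn_nth geq_trans 0 s_sorted); rewrite ?inE // ltnW.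
Qed.

Lemma interlacedP mu mu' :
  reflect (forall i, nth 0 mu' i.+1 <= nth 0 mu i <= nth 0 mu' i)
          (interlaced mu mu').
Proof.
apply: (iffP allP) => [H i | H i _]; last exact: H.
have [lt_i|] := ltnP i (maxn (size mu) (size mu')).
  by apply: H; rewrite mem_iota.
rewrite geq_max => /andP[le_mu le_mu'].
by rewrite !nth_default // ltnW.
Qed.

Lemma part_nth_gt0 s i : is_part s -> (0 < nth 0 s i) = (i < size s).
Proof.
case/andP=> _ s0; have [lt_is|le_si] := ltnP i (size s); last first.
  by rewrite nth_default.
by rewrite lt0n; apply: contraNneq s0 => <-; apply: mem_nth.
Qed.

Lemma part_eq s t :
  is_part s -> is_part t -> (forall i, nth 0 s i = nth 0 t i) -> s = t.
Proof.
move=> s_part t_part eq_st; apply: (eq_from_nth (x0 := 0)) => //.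
have eq_lt i : (i < size s) = (i < size t) by rewrite -!part_nth_gt0 ?eq_st.
by have := eq_lt (size s); have := eq_lt (size t); lia.
Qed.

Lemma leq_sumn s t : (forall i, nth 0 s i <= nth 0 t i) -> sumn s <= sumn t.
Proof.
elim: s t => [|a s IHs] [|b t] //= le_st.
  have a0: a = 0 by have := le_st 0; rewrite leqn0 => /eqP.
  by rewrite a0 (IHs [::]) // => i; have := le_st i.+1; rewrite /= nth_nil.
by rewrite leq_add ?(le_st 0) // IHs // => i; apply: (le_st i.+1).
Qed.

Lemma leq_nth_sumn s i : nth 0 s i <= sumn s.
Proof.
elim: s i => [|a s IHs] [|i] //=; first exact: leq_addr.
exact: leq_trans (IHs i) (leq_addl _ _).
Qed.

(** Containment of Young diagrams is strict unless the sizes differ. *)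
Lemma leq_sumn_eq s t : is_part s -> is_part t ->
  (forall i, nth 0 s i <= nth 0 t i) -> sumn t <= sumn s -> s = t.
Proof.
move=> s_part t_part le_st le_ts; apply: part_eq => // {s_part t_part}.
elim: s t le_st le_ts => [|a s IHs] [|b t] le_st le_ts i //.
- have : nth 0 (b :: t) i <= sumn (b :: t).
    exact: leq_nth_sumn.
  by rewrite nth_nil; move: le_ts => /=; lia.
- by have := le_st i; rewrite nth_nil leqn0 => /eqP.
have /= le0 := le_st 0.
have le_st' i' : nth 0 s i' <= nth 0 t i' := le_st i'.+1.
have := leq_sumn le_st'; move: le_ts => /= le_ts le_s.
case: i => [|i] /=; first by lia.
by apply: IHs => //; lia.
Qed.

Lemma is_part_behead s : is_part s -> is_part (behead s).
Proof.
case: s => //= a s /andP[/path_sorted s_sorted].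
by rewrite inE negb_or => /andP[_ s0]; apply/andP.
Qed.

Lemma is_part_cons a s :
  0 < a -> nth 0 s 0 <= a -> is_part s -> is_part (a :: s).
Proof.
rewrite /is_part inE negb_or eq_sym -lt0n => -> le_sa /andP[s_sorted ->] /=.
by rewrite andbT; case: s le_sa s_sorted => //= b s -> ->.
Qed.

Lemma adjoin_largest a s :
  0 < a -> nth 0 s 0 <= a -> is_part s -> adjoin_part a s = a :: s.
Proof.
move=> a_gt0 le_sa s_part.
have /andP[as_sorted as0] := is_part_cons a_gt0 le_sa s_part.
rewrite /adjoin_part sorted_sort //; last exact: geq_trans.
by apply/all_filterP/allP => b; rewrite lt0n; apply: contraTneq => ->.
Qed.

(** * The set [Theta] *)

Section ThetaDescription.
Import GRing.Theory Num.Theory.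
Local Open Scope ring_scope.

Lemma sum_neq0 (V : nmodType) (I : finType) (P : pred I) (F : I -> V) :
  \sum_(i | P i) F i != 0 -> exists2 i, P i & F i != 0.
Proof.
move=> sum_neq0; apply/exists_inP; apply: contraNT sum_neq0.
move=> /exists_inPn F0; apply/eqP/big1 => i /F0; by rewrite negbK => /eqP.
Qed.

Variable chi : forall n : nat, seq nat * seq nat -> Iirr (weylB n).
Hypothesis chi_indexes : indexes_irr chi.

Lemma chi_inj n x y :
  is_bipart n x -> is_bipart n y -> chi n x = chi n y -> x = y.
Proof.
move=> x_part y_part eq_chi; have /bij_inj inj_chi := chi_indexes n.
by have [] := inj_chi (BiPart x_part) (BiPart y_part) eq_chi.
Qed.

Lemma cfdot_chi_tensor l l' x x' y y' :
  '[chi_tensor chi l l' x x', chi_tensor chi l l' y y']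
    = ((chi l x == chi l y) && (chi l' x' == chi l' y'))%:R.
Proof. by rewrite cfdot_cf_outer !cfdot_irr -natrM mulnb. Qed.

(** A term of [Omega] equals [chi_tensor chi l l' x (c, d)] exactly when its
    inner pair (xi, eta) is (c, b) and its outer pair (xi', eta') is (a, d), for
    x = (a, b): each x comes from one term at most. *)
Lemma mem_Theta l l' c d (x : bipart l) : is_bipart l' (c, d) ->
  (x \in Theta chi l l' (c, d))
    = interlaced c (bpval x).1 && interlaced (bpval x).2 d.
Proof.
move=> cd_part; rewrite inE; case: x => [[a b] ab_part] /=.
have /and3P[/= a_part b_part /eqP size_ab] := ab_part.
have /and3P[/= c_part d_part /eqP size_cd] := cd_part.
apply/existsP/andP => [[i /andP[Omega_i /eqP chi_i]] | [le_ca le_bd]].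
  move: Omega_i; rewrite irr_consttE chi_i /Omega.
  rewrite cfdot_suml => /sum_neq0[r _].
  rewrite cfdot_suml => /sum_neq0[[[c1 b1] cb_part] _].
  rewrite cfdot_suml => /sum_neq0[[a1 a1_part] le_ca].
  rewrite cfdot_suml => /sum_neq0[[d1 d1_part] le_bd].
  rewrite /= in a1_part le_ca d1_part le_bd *.
  rewrite cfdot_chi_tensor pnatr_eq0 eqb0 negbK => /andP[/eqP eq1 /eqP eq2].
  have /and3P[/= c1_part b1_part /eqP size_cb] := cb_part.
  have [/andP[a1p /eqP a1s] /andP[d1p /eqP d1s]] := (a1_part, d1_part).
  have := ltn_ord r; rewrite ltnS leq_min => /andP[le_rl le_rl'].
  have [e1 e2] : (a1, b1) = (a, b).
    apply: (chi_inj _ ab_part eq1); rewrite /is_bipart /= a1p b1_part /= a1s.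
    by apply/eqP; clear -size_cb le_rl; lia.
  have [e3 e4] : (c1, d1) = (c, d).
    apply: (chi_inj _ cd_part eq2); rewrite /is_bipart /= c1_part d1p /= d1s.
    by apply/eqP; clear -size_cb le_rl'; lia.
  by subst.
have le_c : (sumn c <= sumn a)%N.
  by apply: leq_sumn => i; have /interlacedP/(_ i)/andP[] := le_ca.
have le_b : (sumn b <= sumn d)%N.
  by apply: leq_sumn => i; have /interlacedP/(_ i)/andP[] := le_bd.
have [t t_eq] : exists t, 'chi_t = chi_tensor chi l l' (a, b) (c, d).
  by have /irrP[t] := cf_outer_irr (chi l (a, b)) (chi l' (c, d)); exists t.
exists t; rewrite t_eq eqxx andbT.
pose r := (sumn c + sumn b)%N.
have lt_r : (r < (minn l l').+1)%N.
  by rewrite ltnS leq_min /r; clear -le_c le_b size_ab size_cd; lia.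
have cb_part : is_bipart r (c, b) by apply/and3P.
have a_ipart : is_intpart (l - sumn b) a.
  by rewrite /is_intpart a_part -size_ab addnK /=.
have d_ipart : is_intpart (l' - sumn c) d.
  by rewrite /is_intpart d_part -size_cd addKn /=.
have tensor_char x x' : chi_tensor chi l l' x x' \is a character.
  by rewrite cf_outer_char ?irr_char.
rewrite /Omega.
apply: (irr_constt_sum (i0 := Ordinal lt_r)) => // [i _|].
  by rewrite !rpred_sum // => *; rewrite !rpred_sum // => *; rewrite !rpred_sum.
apply: (irr_constt_sum (i0 := BiPart cb_part)) => // [i _|].
  by rewrite !rpred_sum // => *; rewrite !rpred_sum // => *; rewrite !rpred_sum.
apply: (irr_constt_sum (i0 := IntPart a_ipart)) => // [i _|].
  by rewrite !rpred_sum.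
apply: (irr_constt_sum (i0 := IntPart d_ipart)) => //=.
by rewrite irr_consttE t_eq cfdot_chi_tensor !eqxx oner_eq0.
Qed.

End ThetaDescription.

(** * Partial sums *)

Definition psum (s : seq nat) (i : nat) : nat := \sum_(k < i) nth 0 s k.

Lemma psumS s i : psum s i.+1 = psum s i + nth 0 s i.
Proof. by rewrite /psum big_ord_recr. Qed.

Lemma psum0 s : psum s 0 = 0.
Proof. by rewrite /psum big_ord0. Qed.

Lemma psum_cons a s i : psum (a :: s) i.+1 = a + psum s i.
Proof. by rewrite /psum big_ord_recl. Qed.

Lemma sumn_take s i : sumn (take i s) = psum s i.
Proof.
elim: s i => [|a s IHs] [|i] //=; rewrite ?psum0 ?psum_cons ?IHs //.
by rewrite /psum big1 // => k _; rewrite nth_nil.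
Qed.

Lemma eq_psum s t i : (forall k, nth 0 s k = nth 0 t k) -> psum s i = psum t i.
Proof. by move=> eq_st; apply: eq_bigr => k _. Qed.

Lemma psum_size s i : size s <= i -> psum s i = sumn s.
Proof. by move=> le_si; rewrite -sumn_take take_oversize. Qed.

(** Since the parts are sorted, only trailing zeros are removed. *)
Lemma nth_nz s i : sorted geq s -> nth 0 (nz s) i = nth 0 s i.
Proof.
elim: s i => //= a s IHs i as_sorted.
have s_sorted := path_sorted as_sorted.
case: posnP => [a0|a_gt0]; last by case: i => //= i; apply: IHs.
have all0 k : nth 0 (a :: s) k = 0.
  elim: k => [|k IHk] //.
  have := sorted_geq_nthS k (as_sorted : sorted geq (a :: s)).
  by rewrite IHk leqn0 => /eqP.
by rewrite all0 IHs //; apply: (all0 i.+1).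
Qed.

(** * Symplectic partitions and their halves *)

(** In a symplectic partition the odd parts occur in adjacent equal pairs. *)
Lemma symplectic_ind (P : seq nat -> Prop) :
    P [::] ->
    (forall a s, ~~ odd a -> P s -> P (a :: s)) ->
    (forall a s, odd a -> P s -> P (a :: a :: s)) ->
  forall s, sorted geq s -> symplectic_part s -> P s.
Proof.
move=> P0 Peven Podd s; have [n] := ubnP (size s); elim: n s => // n IHn s.
case: s => [|a s] //= /ltnSE lt_sn as_sorted /allP as_sympl.
have even_count b : odd b -> ~~ odd (count_mem b (a :: s)).
  move=> b_odd; have [/as_sympl|] := boolP (b \in a :: s).
    by rewrite b_odd.
  by rewrite -has_pred1 has_count -leqNgt leqn0 => /eqP->.
have s_sorted := path_sorted as_sorted.
have [a_odd|a_even] := boolP (odd a); last first.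
  apply: Peven => //; apply: IHn => //.
  apply/allP => b _; apply/implyP => b_odd; have := even_count b b_odd.
  by rewrite /=; case: eqP a_even => [->|//]; rewrite b_odd.
have := even_count a a_odd; rewrite /= eqxx /=.
case: s as_sorted s_sorted lt_sn even_count {as_sympl} => //= b s.
case/andP=> le_ba bs_sorted _ lt_sn even_count.
have [eq_ba|neq_ba] := eqVneq b a; last first.
  suff -> : count_mem a s = 0 by [].
  apply/count_memPn; apply: contra neq_ba => s_a.
  have /allP/(_ a s_a) := order_path_min geq_trans bs_sorted.
  by rewrite eqn_leq le_ba.
move=> _; rewrite eq_ba in bs_sorted even_count *; apply: Podd => //.
apply: IHn; [exact: ltnW | exact: path_sorted bs_sorted |].
apply/allP => c _; apply/implyP => /even_count /=.
by case: (a == c); rewrite //= negbK.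
Qed.

(** The differences of the consecutive partial sums of [s], each halved and
    rounded down; the bit [b] carries the parity of what precedes [s]. *)
Fixpoint halves (b : bool) (s : seq nat) : seq nat :=
  if s is a :: s' then (a + b)./2 :: halves (odd a (+) b) s' else [::].

Lemma size_halves b s : size (halves b s) = size s.
Proof. by elim: s b => //= a s IHs b; rewrite IHs. Qed.

Lemma psum_halves s i : psum (halves false s) i = (psum s i)./2.
Proof.
suff H b : psum (halves b s) i = (psum s i + b)./2 by rewrite H addn0.
elim: s b i => [|a s IHs] b [|i]; rewrite ?psum0 /=; try by case: b.
  by rewrite !psum_size //=; case: b.
by rewrite !psum_cons IHs; lia.
Qed.

Lemma nth_halves s i :
  nth 0 (halves false s) i = (psum s i.+1)./2 - (psum s i)./2.
Proof. by rewrite -!psum_halves psumS addKn. Qed.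

Lemma halves_interleaved s i : sorted geq s ->
  nth 0 (halves false s) i.+2 <= nth 0 (halves false s) i.
Proof.
move=> s_sorted; rewrite !nth_halves !psumS.
have := sorted_geq_nthS i s_sorted; have := sorted_geq_nthS i.+1 s_sorted; lia.
Qed.

Lemma halves_leS s i : sorted geq s ->
  nth 0 (halves false s) i.+1 <= (nth 0 (halves false s) i).+1.
Proof.
move=> s_sorted; rewrite !nth_halves !psumS.
have := sorted_geq_nthS i s_sorted; lia.
Qed.

(** The partial sums that are odd stop in the middle of a pair of odd parts;
    these are the only places where the halves increase. *)
Lemma halves_ascent s i : sorted geq s -> symplectic_part s ->
  odd (psum s i.+1) ->
  nth 0 (halves false s) i.+1 = (nth 0 (halves false s) i).+1.
Proof.
move=> s_sorted s_sympl odd_i.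
suff [even_i eq_i] : ~~ odd (psum s i) /\ nth 0 s i.+1 = nth 0 s i.
  by move: odd_i even_i; rewrite !nth_halves !psumS eq_i; lia.
move: i odd_i;
apply: (symplectic_ind (P := fun t => forall i, odd (psum t i.+1) ->
          ~~ odd (psum t i) /\ nth 0 t i.+1 = nth 0 t i) _ _ _ s_sorted s_sympl)
  => {s s_sorted s_sympl}.
- by move=> i; rewrite psum_size.
- move=> a s a_even IHs [|i];
    rewrite psum_cons ?psum0 ?addn0 ?(negPf a_even) //.
  by rewrite psum_cons oddD (negPf a_even) => /IHs[even_i eq_i]; split;
    rewrite ?oddD ?(negPf a_even).
move=> a s a_odd IHs [|[|i]]; rewrite !psum_cons ?psum0 ?oddD ?a_odd //=.
by rewrite !negbK => /IHs.
Qed.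

(** * From symplectic partitions to bipartitions *)

Fixpoint alternate (b : bool) (s : seq nat) : seq nat :=
  if s is a :: s' then
    if b then a :: alternate false s' else alternate true s'
  else [::].

Lemma size_alternate b s :
  size (alternate b s) = if b then uphalf (size s) else (size s)./2.
Proof. by elim: s b => [|a s IHs] [] //=; rewrite IHs. Qed.

Lemma nth_alternate b s i :
  nth 0 (alternate b s) i = nth 0 s (if b then i.*2 else i.*2.+1).
Proof.
by elim: s b i => [|a s IHs] [] [|i] //=; rewrite ?nth_nil ?IHs.
Qed.

(** Adding a staircase makes sorted lists strict: [star] has steps of height
    one and [half_star] has steps of height one every other position. *)
Fixpoint star (s : seq nat) : seq nat :=
  if s is a :: s' then a + size s' :: star s' else [::].

Fixpoint half_star (s : seq nat) : seq nat :=
  if s is a :: s' then a + (size s')./2 :: half_star s' else [::].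

Lemma size_star s : size (star s) = size s.
Proof. by elim: s => //= a s ->. Qed.

Lemma size_half_star s : size (half_star s) = size s.
Proof. by elim: s => //= a s ->. Qed.

Lemma nth_star s i :
  i < size s -> nth 0 (star s) i = nth 0 s i + (size s - i.+1).
Proof. by elim: s i => // a s IHs [|i] /=; [rewrite subn1 | apply: IHs]. Qed.

Lemma nth_half_star s i :
  i < size s -> nth 0 (half_star s) i = nth 0 s i + (size s - i.+1)./2.
Proof. by elim: s i => // a s IHs [|i] /=; [rewrite subn1 | apply: IHs]. Qed.

(** A pair of equal odd parts gives two consecutive entries of [star s] whose
    parities are exchanged, and [halves] restores the alternation: the entries
    of either parity are those of every other position of the halved list. *)
Lemma star_parity s b : sorted geq s -> symplectic_part s ->
  [seq a./2 | a <- star s & odd a (+) odd (size s) == b]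
    = alternate b (half_star (halves false s)).
Proof.
move=> s_sorted s_sympl; move: b.
apply: (symplectic_ind (P := fun t => forall b,
    [seq a./2 | a <- star t & odd a (+) odd (size t) == b]
      = alternate b (half_star (halves false t))) _ _ _ s_sorted s_sympl)
  => {s s_sorted s_sympl} // [a s a_even IHs b|a s a_odd IHs b] /=.
  rewrite (negPf a_even) addbF size_halves -(IHs true) -(IHs false).
  have -> : odd (a + size s) (+) ~~ odd (size s) by lia.
  have eqP c : [seq x <- star s | odd x (+) ~~ odd (size s) == c]
             = [seq x <- star s | odd x (+) odd (size s) == ~~ c].
    by apply: eq_filter => x; rewrite addbN; case: c; case: (odd x (+) _).
  by case: b => /=; rewrite !eqP //; congr (_ :: _); lia.
rewrite a_odd !addbF /= negbK size_halves -(IHs true) -(IHs false).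
have -> : odd (a + (size s).+1) (+) odd (size s) = false by lia.
have -> : odd (a + size s) (+) odd (size s) by lia.
by case: b => /=; congr (_ :: _); lia.
Qed.

Lemma sorted_mkseq (f : nat -> nat) n : (forall i, i.+1 < n -> f i.+1 <= f i) ->
  sorted geq (mkseq f n).
Proof.
move=> f_decr; apply/(sortedP 0) => i; rewrite size_mkseq => lt_in.
by rewrite (nth_mkseq _ _ lt_in) (nth_mkseq _ _ (ltnW lt_in)); apply: f_decr.
Qed.

Lemma unstep_rev j u : size u = j ->
  unstep j (rev u) = nz (mkseq (fun i => nth 0 u i - (j - i.+1)) j).
Proof.
move=> size_u; congr nz; apply/eq_in_map => i; rewrite mem_iota /= => lt_ij.
by rewrite nth_rev size_u; [congr (nth 0 u _ - _); lia | lia].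
Qed.

(** The definition splits [la_star s] by parity; [star_parity] turns this into a
    splitting of the halved list by position. *)
Lemma nth_springer_bipart s i : sorted geq s -> symplectic_part s ->
  nth 0 (springer_bipart s).1 i = nth 0 (halves false s) i.*2
  /\ nth 0 (springer_bipart s).2 i = nth 0 (halves false s) i.*2.+1.
Proof.
move=> s_sorted s_sympl; set j := uphalf (size s).
(* The definition of [springer_bipart] pads [s] to an even length. *)
pose p := s ++ nseq (odd (size s)) 0.
have nth_p k : nth 0 p k = nth 0 s k.
  rewrite nth_cat; case: ltnP => // le_sk.
  by rewrite nth_nseq if_same nth_default.
have size_p : size p = j.*2 by rewrite size_cat size_nseq /j; lia.
have p_sorted : sorted geq p.
  by apply/(sortedP 0) => k _; rewrite !nth_p; apply: sorted_geq_nthS.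
have p_sympl : symplectic_part p.
  have count_p a : odd a -> count_mem a p = count_mem a s.
    move=> a_odd; rewrite count_cat count_nseq /=.
    by case: eqP a_odd => [<-|] //; rewrite addn0.
  rewrite /symplectic_part all_cat; apply/andP; split.
    apply/allP => a s_a; apply/implyP => a_odd; rewrite count_p //.
    by have /allP/(_ a s_a) := s_sympl; rewrite a_odd.
  by apply/allP => a /nseqP[->].
have halves_p k : nth 0 (halves false p) k = nth 0 (halves false s) k.
  by rewrite !nth_halves !(eq_psum _ nth_p).
have la_starE : la_star s = rev (star p).
  apply: (eq_from_nth (x0 := 0));
    rewrite /la_star size_mkseq ?size_rev ?size_star //.
  move=> k lt_k; rewrite nth_mkseq // nth_rev ?size_star size_p //.
  rewrite nth_star size_p ?nth_p; last by lia.
  by congr addn; rewrite -/j in lt_k *; lia.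
(* [la_star] lists [star p] in increasing order. *)
have rows b : [seq a./2 | a <- la_star s & odd a == b]
    = rev (alternate b (half_star (halves false p))).
  rewrite la_starE filter_rev map_rev -star_parity // size_p odd_double.
  by congr (rev _); congr map; apply: eq_filter => a; rewrite addbF.
(* The half staircase in each row is the one that [unstep] removes, so [nz]
   meets a sorted list. *)
have decr b k : k.+1 < j ->
    nth 0 (alternate b (half_star (halves false p))) k.+1 - (j - k.+2)
      <= nth 0 (alternate b (half_star (halves false p))) k - (j - k.+1).
  move=> lt_kj; rewrite !nth_alternate !nth_half_star ?size_halves size_p;
    try by case: (b); lia.
  case: b; [have := halves_interleaved k.*2 p_sorted |
            have := halves_interleaved k.*2.+1 p_sorted].
    rewrite doubleS; lia.
  rewrite doubleS; lia.
have nth_row b :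
    nth 0 (unstep j (rev (alternate b (half_star (halves false p))))) i =
      nth 0 (halves false s) (if b then i.*2 else i.*2.+1).
  rewrite unstep_rev ?size_alternate ?size_half_star ?size_halves; last first.
    by rewrite size_p /j; case: (b); lia.
  rewrite nth_nz; last by apply: sorted_mkseq => k; apply: decr.
  have [lt_ij|le_ji] := ltnP i j; last first.
    rewrite -halves_p !nth_default ?size_mkseq // size_halves size_p.
    by case: (b); lia.
  rewrite nth_mkseq // nth_alternate nth_half_star size_halves size_p;
    last first.
    by case: (b); lia.
  by rewrite halves_p; case: (b); lia.
split; rewrite -/j.
  rewrite /= -/j -(nth_row true) -rows; congr (nth _ (unstep _ (map _ _)) _).
  by apply: eq_filter => a; rewrite eqb_id.
rewrite /= -/j -(nth_row false) -rows; congr (nth _ (unstep _ (map _ _)) _).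
by apply: eq_filter => a; rewrite eqbF_neg.
Qed.

(** * The sorted entries of a u-symbol *)

Lemma perm_mkseq_interleave (f : nat -> nat) n :
  perm_eq (mkseq (f \o double) n.+1 ++ mkseq (f \o succn \o double) n)
          (mkseq f n.*2.+1).
Proof.
elim: n => // n IHn.
have -> : mkseq f n.+1.*2.+1 = mkseq f n.*2.+1 ++ [:: f n.*2.+1; f n.*2.+2].
  by rewrite doubleS 2!mkseqS -!cats1 -catA.
rewrite (mkseqS _ n.+1) (mkseqS (f \o succn \o double) n) -!cats1.
rewrite -catA perm_sym.
rewrite -(permPl (perm_cat IHn (perm_refl _))) -!catA perm_cat2l.
by rewrite perm_sym perm_catCA perm_cat2l perm_catC.
Qed.

(** The decreasing enumeration of a u-symbol whose rows interleave to [e]. *)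
Definition stair (n : nat) (e : seq nat) : seq nat :=
  mkseq (fun i => nth 0 e i + (n.*2 - i)) n.*2.+1.

Lemma rev_mkseq (f : nat -> nat) n :
  rev (mkseq f n) = mkseq (fun i => f (n - i.+1)) n.
Proof.
apply: (eq_from_nth (x0 := 0)); rewrite ?size_rev ?size_mkseq // => i lt_in.
by rewrite nth_rev size_mkseq // !nth_mkseq //; lia.
Qed.

Lemma usymbol_rev1 n x :
  rev (usymbol n x).1 = mkseq (fun i => nth 0 x.1 i + (n - i).*2) n.+1.
Proof.
rewrite rev_mkseq; apply/eq_in_map => i; rewrite mem_iota /= => lt_in.
by rewrite subSS; congr (nth _ _ _ + _); lia.
Qed.

Lemma usymbol_rev2 n x :
  rev (usymbol n x).2 = mkseq (fun i => nth 0 x.2 i + (n.*2 - i.*2.+1)) n.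
Proof.
rewrite rev_mkseq; apply/eq_in_map => i; rewrite mem_iota /= => lt_in.
by congr (nth _ _ _ + _); lia.
Qed.

Definition entries n x : seq nat :=
  sort geq ((usymbol n x).1 ++ (usymbol n x).2).

Lemma geq_total : total geq.
Proof. by move=> a b; apply: leq_total. Qed.

Lemma geq_anti : antisymmetric geq.
Proof. by move=> a b /andP[ab ba]; apply/anti_leq/andP. Qed.

Lemma similar_entries n x y :
  similar_symbols (usymbol n x) (usymbol n y) = (entries n x == entries n y).
Proof. by apply/(perm_sortP geq_total geq_trans geq_anti)/eqP. Qed.

Lemma entries_sorted n x : sorted geq (entries n x).
Proof. exact: sort_sorted geq_total _. Qed.

(** The interleaved sequence may ascend by at most one at each step, which is
    the slope of the staircase: so [stair n e] is decreasing. *)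
Lemma entries_interleaved n x e :
    (forall i, nth 0 x.1 i = nth 0 e i.*2 /\ nth 0 x.2 i = nth 0 e i.*2.+1) ->
    (forall i, nth 0 e i.+1 <= (nth 0 e i).+1) ->
  entries n x = stair n e.
Proof.
move=> xE e_le; apply: (sorted_eq geq_trans geq_anti (entries_sorted n x)).
  by apply: sorted_mkseq => i lt_in; have := e_le i; lia.
rewrite perm_sort -(permPr (perm_mkseq_interleave _ n)).
apply: perm_cat; rewrite -perm_rev ?usymbol_rev1 ?usymbol_rev2.
  suff -> : mkseq (fun i => nth 0 x.1 i + (n - i).*2) n.+1
      = mkseq ((fun i => nth 0 e i + (n.*2 - i)) \o double) n.+1 by [].
  apply/eq_in_map => i _ /=; have [-> _] := xE i; lia.
suff -> : mkseq (fun i => nth 0 x.2 i + (n.*2 - i.*2.+1)) n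
    = mkseq ((fun i => nth 0 e i + (n.*2 - i)) \o succn \o double) n by [].
apply/eq_in_map => i _ /=; have [_ ->] := xE i; lia.
Qed.

Lemma entries_springer_bipart n s : sorted geq s -> symplectic_part s ->
  entries n (springer_bipart s) = stair n (halves false s).
Proof.
move=> s_sorted s_sympl; apply: entries_interleaved => i.
  exact: nth_springer_bipart.
exact: halves_leS.
Qed.

Lemma distinguished_springer_bipart n s : sorted geq s -> symplectic_part s ->
  distinguished_symbol (usymbol n (springer_bipart s)).
Proof.
move=> s_sorted s_sympl; apply/allP => i.
rewrite mem_iota add0n size_mkseq => /andP[_ lt_in].
have lt_inS : i < n.+1 by apply: ltnW.
rewrite (nth_mkseq _ _ lt_inS) (nth_mkseq _ _ lt_in) nth_mkseq ?ltnS //.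
have nthE k := nth_springer_bipart k s_sorted s_sympl.
have [_ ->] := nthE (n - i.+1); have [-> _] := nthE (n - i).
have [-> _] := nthE (n - i.+1).
have -> : n - i = (n - i.+1).+1 by lia.
rewrite doubleS.
have := halves_leS (n - i.+1).*2 s_sorted.
have := halves_leS (n - i.+1).*2.+1 s_sorted; lia.
Qed.

(** * Existence of the symplectic partition *)

(** The inverse of [halves] on symplectic partitions: an ascent of [e] is the
    trace of a pair of equal odd parts. *)
Fixpoint unhalve (e : seq nat) : seq nat :=
  if e is a :: e1 then
    if e1 is b :: e2 then
      if b == a.+1 then [:: a.*2.+1, a.*2.+1 & unhalve e2]
      else a.*2 :: unhalve e1
    else [:: a.*2]
  else [::].

Lemma unhalve_ind (P : seq nat -> seq nat -> Prop) :
    P [::] [::] ->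
    (forall a e, nth 0 e 0 <> a.+1 -> P e (unhalve e) ->
       P (a :: e) (a.*2 :: unhalve e)) ->
    (forall a e, P e (unhalve e) ->
       P [:: a, a.+1 & e] [:: a.*2.+1, a.*2.+1 & unhalve e]) ->
  forall e, P e (unhalve e).
Proof.
move=> P0 Peven Podd e; have [n] := ubnP (size e); elim: n e => // n IHn.
case=> [|a [|b e]] //= /ltnSE lt_en; first exact: (Peven a [::]).
case: eqP => [->|neq_ba]; first by apply: Podd; apply: IHn; apply: ltnW.
exact: (Peven a (b :: e) neq_ba (IHn (b :: e) lt_en)).
Qed.

Lemma unhalveK e : halves false (unhalve e) = e.
Proof.
elim/unhalve_ind: e / (unhalve e) => //= [a e _|a e] IHe;
  rewrite odd_double /= IHe //.
  by rewrite addn0 doubleK.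
by congr [:: _, _ & _]; lia.
Qed.

Lemma unhalve_symplectic e : symplectic_part (unhalve e).
Proof.
suff even_count b : odd b -> ~~ odd (count_mem b (unhalve e)).
  by apply/allP => b _; apply/implyP => /even_count.
move=> b_odd; elim/unhalve_ind: e / (unhalve e) => //= a e.
  by move=> _; case: eqP b_odd => [<-|//]; rewrite odd_double.
by case: eqP; rewrite //= negbK.
Qed.

(** The head of [unhalve e] exceeds twice the head of [e] only at an ascent. *)
Lemma head_unhalve e :
  nth 0 (unhalve e) 0 = (nth 0 e 0).*2 + (nth 0 e 1 == (nth 0 e 0).+1).
Proof.
case: e => [|a [|b e]] //=; first by rewrite addn0.
by case: eqP => _ /=; rewrite ?addn1 ?addn0.
Qed.

Lemma sorted_cons a s : nth 0 s 0 <= a -> sorted geq s -> sorted geq (a :: s).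
Proof. by case: s => //= b s -> ->. Qed.

(** The first condition makes the descents of [e] compensate its ascents: a pair
    of odd parts that starts at [a] is followed by parts at most [a.*2.+1]. *)
Lemma unhalve_sorted e :
    (forall i, nth 0 e i.+2 <= nth 0 e i) ->
    (forall i, nth 0 e i.+1 <= (nth 0 e i).+1) ->
  sorted geq (unhalve e).
Proof.
elim/unhalve_ind: e / (unhalve e) => // a e; [move=> neq_a|];
  move=> IHe le2 le1.
  have /= le1_0 := le1 0; have /= le2_0 := le2 0.
  apply: sorted_cons; first by rewrite head_unhalve; lia.
  by apply: IHe => i; [apply: (le2 i.+1) | apply: (le1 i.+1)].
have /= le2_0 := le2 0; have /= le2_1 := le2 1.
have tail_sorted : sorted geq (a.*2.+1 :: unhalve e).
  apply: sorted_cons; first by rewrite head_unhalve; lia.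
  by apply: IHe => i; [apply: (le2 i.+2) | apply: (le1 i.+2)].
by rewrite ltnSn.
Qed.

(** Two neighbours in a row of a u-symbol differ by at least two, so a row
    meets an interval of length two at most once. *)
Lemma count_window_le1 t u : sorted (fun a b => b.+2 <= a) u ->
  count (fun a => t <= a <= t.+1) u <= 1.
Proof.
have gap_trans : transitive (fun a b => b.+2 <= a) by move=> a b c; lia.
elim: u => //= a u IHu au_sorted.
have [/andP[le_ta le_at]|_] := boolP (t <= a <= t.+1); last first.
  exact: IHu (path_sorted au_sorted).
suff -> : count (fun b => t <= b <= t.+1) u = 0 by [].
apply/eqP; rewrite -leqn0 leqNgt -has_count; apply/hasPn => b u_b.
by have /allP/(_ b u_b) := order_path_min gap_trans au_sorted; lia.
Qed.

Lemma count_entries (P : pred nat) n x :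
  count P (entries n x)
    = count P (rev (usymbol n x).1) + count P (rev (usymbol n x).2).
Proof.
rewrite !count_rev -count_cat.
have /seq.permP-> // :
  perm_eq (entries n x) ((usymbol n x).1 ++ (usymbol n x).2).
by rewrite perm_sort.
Qed.

Lemma size_entries n x : size (entries n x) = n.*2.+1.
Proof. by rewrite size_sort size_cat !size_mkseq; lia. Qed.

(** Three entries in an interval of length two would put two of them in one
    row. *)
Lemma entries_gap n x i : sorted geq x.1 -> sorted geq x.2 -> i.+2 < n.*2.+1 ->
  (nth 0 (entries n x) i.+2).+2 <= nth 0 (entries n x) i.
Proof.
move=> x1_sorted x2_sorted lt_in; rewrite leqNgt; apply/negP => lt_ii2.
set w := entries n x in lt_ii2; pose t := nth 0 w i.+2.
have size_w : size w = n.*2.+1 by apply: size_entries.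
have w_sorted : sorted geq w by apply: entries_sorted.
suff : 3 <= count (fun a => t <= a <= t.+1) w.
  suff le2 : count (fun a => t <= a <= t.+1) w <= 2 by move/leq_trans/(_ le2).
  rewrite count_entries (leq_add (n1 := 1) (n2 := 1)) // count_window_le1 //.
    rewrite usymbol_rev1; apply/(sortedP 0) => k; rewrite size_mkseq => lt_kn.
    rewrite (nth_mkseq _ _ lt_kn) (nth_mkseq _ _ (ltnW lt_kn)).
    by have := sorted_geq_nthS k x1_sorted; lia.
  rewrite usymbol_rev2; apply/(sortedP 0) => k; rewrite size_mkseq => lt_kn.
  rewrite (nth_mkseq _ _ lt_kn) (nth_mkseq _ _ (ltnW lt_kn)).
  by have := sorted_geq_nthS k x2_sorted; lia.
rewrite -(cat_take_drop i w) count_cat.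
do 3![rewrite (drop_nth 0); last by rewrite size_w; lia].
have := sorted_geq_nthS i w_sorted; have := sorted_geq_nthS i.+1 w_sorted.
rewrite /= -/t; rewrite -/t in lt_ii2; lia.
Qed.

(** The smallest two entries are at least 0 and 1, since 0 occurs only once;
    [entries_gap] then moves up two places at a time. *)
Lemma entries_ge n x i : sorted geq x.1 -> sorted geq x.2 -> i <= n.*2 ->
  n.*2 - i <= nth 0 (entries n x) i.
Proof.
move=> x1_sorted x2_sorted le_in.
suff H k : k <= n.*2 -> k <= nth 0 (entries n x) (n.*2 - k).
  by have := H (n.*2 - i) (leq_subr _ _); rewrite subKn.
have [m] := ubnP k; elim: m k => // m IHm [|[|k]] // lt_km le_kn.
  rewrite lt0n; apply/eqP => w0; set w := entries n x in w0.
  have w_sorted : sorted geq w by apply: entries_sorted.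
  have size_w : size w = n.*2.+1 by apply: size_entries.
  (* Otherwise the last two entries vanish, but no entry of the second row
     does, and only one of the first. *)
  suff : 2 <= count (pred1 0) w.
    rewrite count_entries.
    suff -> : count (pred1 0) (rev (usymbol n x).2) = 0.
      suff : count (fun a => 0 <= a <= 1) (rev (usymbol n x).1) <= 1.
        have /leq_trans le_count : count (pred1 0) (rev (usymbol n x).1)
            <= count (fun a => 0 <= a <= 1) (rev (usymbol n x).1).
          by apply: sub_count => a /eqP->.
        by move=> /le_count le1; rewrite addn0 ltnNge le1.
      apply: count_window_le1.
      rewrite usymbol_rev1; apply/(sortedP 0) => j; rewrite size_mkseq => lt_jn.
      rewrite (nth_mkseq _ _ lt_jn) (nth_mkseq _ _ (ltnW lt_jn)).
      by have := sorted_geq_nthS j x1_sorted; lia.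
    apply/eqP; rewrite -leqn0 leqNgt -has_count; apply/hasPn => b.
    by rewrite mem_rev => /mapP[j _ ->]; rewrite /= addnS.
  rewrite -(cat_take_drop (n.*2 - 1) w) count_cat.
  do 2![rewrite (drop_nth 0); last by rewrite size_w; lia].
  have := sorted_geq_nthS (n.*2 - 1) w_sorted.
  by rewrite /= w0 leqn0 => ->; lia.
have lt_i : (n.*2 - k.+2).+2 < n.*2.+1 by lia.
have := entries_gap x1_sorted x2_sorted lt_i.
have -> : (n.*2 - k.+2).+2 = n.*2 - k by lia.
have : k <= nth 0 (entries n x) (n.*2 - k) by apply: IHm; lia.
lia.
Qed.

Lemma psum_mkseq f n i : i <= n -> psum (mkseq f n) i = \sum_(k < i) f k.
Proof.
move=> le_in; apply: eq_bigr => k _.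
by rewrite nth_mkseq // (leq_trans (ltn_ord k)).
Qed.

Lemma sumn_mkseq f n : sumn (mkseq f n) = \sum_(k < n) f k.
Proof. by rewrite -(psum_mkseq f (leqnn n)) psum_size ?size_mkseq. Qed.

Lemma part_size s : is_part s -> size s <= sumn s.
Proof.
elim: s => //= a s IHs as_part; have := part_nth_gt0 0 as_part.
by have := IHs (is_part_behead as_part); rewrite /=; lia.
Qed.

Lemma psum_row1 n x p : p <= n.+1 ->
  psum (rev (usymbol n x).1) p = psum x.1 p + \sum_(i < p) (n - i).*2.
Proof. by move=> le_pn; rewrite usymbol_rev1 psum_mkseq // big_split. Qed.

Lemma psum_row2 n x q : q <= n ->
  psum (rev (usymbol n x).2) q = psum x.2 q + \sum_(i < q) (n.*2 - i.*2.+1).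
Proof. by move=> le_qn; rewrite usymbol_rev2 psum_mkseq // big_split. Qed.

Lemma psum_stair n e i : i <= n.*2.+1 ->
  psum (stair n e) i = psum e i + \sum_(k < i) (n.*2 - k).
Proof. by move=> le_in; rewrite psum_mkseq // big_split. Qed.

Lemma sumn_entries n x : is_bipart n x ->
  sumn (entries n x) = n + \sum_(k < n.*2.+1) (n.*2 - k).
Proof.
case/and3P=> x1_part x2_part /eqP size_x.
have -> : sumn (entries n x)
    = sumn (rev (usymbol n x).1) + sumn (rev (usymbol n x).2).
  rewrite !sumn_rev -sumn_cat; apply: perm_sumn; by rewrite perm_sort.
have size_x1 := part_size x1_part; have size_x2 := part_size x2_part.
rewrite -(psum_size (i := n.+1)) ?size_rev ?size_mkseq //.
rewrite -(psum_size (i := n)) ?size_rev ?size_mkseq //.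
rewrite psum_row1 // psum_row2 // !psum_size; try lia.
rewrite addnACA size_x; congr addn.
rewrite -(sumn_mkseq (fun k => n.*2 - k)).
rewrite -(perm_sumn (perm_mkseq_interleave _ n)) sumn_cat !sumn_mkseq.
by congr addn; apply: eq_bigr => k _ /=; lia.
Qed.

Lemma part_nz s : sorted geq s -> is_part (nz s).
Proof.
move=> s_sorted; apply/andP; split; first exact: (sorted_filter geq_trans).
by rewrite mem_filter.
Qed.

Lemma nz_symplectic s : symplectic_part s -> symplectic_part (nz s).
Proof.
move=> /allP s_sympl; apply/allP => a; rewrite mem_filter => /andP[a_gt0 s_a].
have := s_sympl a s_a; rewrite count_filter.
suff -> : count [predI pred1 a & ltn 0] s = count_mem a s by [].
apply: eq_count => b; rewrite !inE.
by case: (b =P a) => [->|]; rewrite ?inE ?unfold_in ?a_gt0.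
Qed.

(** Removing the staircase from the sorted entries of the u-symbol of [x] leaves
    the sequence [e] of the distinguished u-symbol in its similarity class, and
    [unhalve e] is the partition. *)
Lemma springer_exists n x : is_bipart n x ->
  exists s, [/\ is_intpart n.*2 s, symplectic_part s
    & entries n x = entries n (springer_bipart s)].
Proof.
move=> x_part; have /and3P[/andP[x1_sorted _] /andP[x2_sorted _] _] := x_part.
set w := entries n x.
have size_w : size w = n.*2.+1 by apply: size_entries.
have w_sorted : sorted geq w by apply: entries_sorted.
have w_ge i : i <= n.*2 -> n.*2 - i <= nth 0 w i by apply: entries_ge.
pose e := mkseq (fun i => nth 0 w i - (n.*2 - i)) n.*2.+1.
have eE i : nth 0 e i = nth 0 w i - (n.*2 - i).
  have [lt_in|le_ni] := ltnP i n.*2.+1; first by rewrite nth_mkseq.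
  by rewrite !nth_default ?size_mkseq ?size_w.
have stair_e : stair n e = w.
  apply: (eq_from_nth (x0 := 0)); rewrite size_mkseq // => i lt_in.
  by rewrite nth_mkseq // eE subnK // w_ge.
have e_le i : nth 0 e i.+1 <= (nth 0 e i).+1.
  by rewrite !eE; have := sorted_geq_nthS i w_sorted; lia.
have e_le2 i : nth 0 e i.+2 <= nth 0 e i.
  have [lt_in|le_ni] := ltnP i.+2 n.*2.+1; last first.
    by rewrite nth_default ?size_mkseq.
  have := entries_gap x1_sorted x2_sorted lt_in.
  by rewrite !eE -/w; lia.
have u_sorted := unhalve_sorted e_le2 e_le.
have s_sympl := nz_symplectic (unhalve_symplectic e).
have s_part := part_nz u_sorted.
have /andP[s_sorted _] := s_part.
have nth_s i : nth 0 (nz (unhalve e)) i = nth 0 (unhalve e) i by apply: nth_nz.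
have halves_s i : nth 0 (halves false (nz (unhalve e))) i = nth 0 e i.
  by rewrite -[in RHS](unhalveK e) !nth_halves !(eq_psum _ nth_s).
exists (nz (unhalve e)); split=> //; last first.
  rewrite entries_springer_bipart // -/w -stair_e.
  by apply/eq_in_map => i _; rewrite halves_s.
rewrite /is_intpart s_part; apply/eqP.
have even_sum : ~~ odd (sumn (nz (unhalve e))).
  apply: (symplectic_ind (P := fun t => ~~ odd (sumn t))
    _ _ _ s_sorted s_sympl).
  - by [].
  - by move=> a s a_even s_even /=; clear -a_even s_even; lia.
  - by move=> a s a_odd s_even /=; clear -a_odd s_even; lia.
suff : (sumn (nz (unhalve e)))./2 = n by lia.
set s := nz _ in halves_s even_sum *.
rewrite -(psum_size (leq_maxl (size s) (n.*2.+1))) -psum_halves.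
rewrite (eq_psum _ halves_s) psum_size ?size_mkseq ?leq_maxr //.
have := sumn_entries x_part; rewrite -/w -stair_e.
rewrite -(psum_size (i := n.*2.+1)) ?size_mkseq // psum_stair //.
by rewrite psum_size ?size_mkseq // => /addIn.
Qed.

(** The partition is only known through the similarity class of its u-symbol,
    but the last item determines all its halved partial sums. *)
Lemma springer_partP n x : is_bipart n x ->
  [/\ is_part (springer_part n x), sumn (springer_part n x) = n.*2,
      symplectic_part (springer_part n x)
    & entries n x = stair n (halves false (springer_part n x))].
Proof.
move=> x_part; rewrite /springer_part; case: pickP => [la|no_la].
  have /andP[la_part /eqP size_la] := valP la.
  have /andP[la_sorted _] := la_part.
  case/and3P=> la_sympl _; rewrite similar_entries => /eqP->.
  by split; rewrite // entries_springer_bipart.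
have [s [s_ipart s_sympl eq_s]] := springer_exists x_part.
have /andP[/andP[s_sorted _] _] := s_ipart.
have := no_la (IntPart s_ipart); rewrite /= s_sympl similar_entries eq_s eqxx.
by rewrite distinguished_springer_bipart.
Qed.

Lemma halves_descent s i : sorted geq s -> ~~ odd (psum s i.+1) ->
  nth 0 (halves false s) i.+1 <= nth 0 (halves false s) i.
Proof.
move=> s_sorted; rewrite !nth_halves !psumS.
have := sorted_geq_nthS i s_sorted; lia.
Qed.

(** Domination of symplectic partitions only involves the halved partial sums:
    where these agree at [i] and the first partial sum is odd, the halves of the
    first partition ascend at [i], which forces an ascent of the second. *)
Lemma psum_le_halves s t i :
    sorted geq s -> symplectic_part s -> sorted geq t -> symplectic_part t ->
    (forall k, k <= i.+1 ->
       psum (halves false s) k <= psum (halves false t) k) ->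
  psum s i <= psum t i.
Proof.
move=> s_sorted s_sympl t_sorted t_sympl; case: i => [|i] le_st.
  by rewrite !psum0.
have le0 := le_st i (leq_trans (leqnSn i) (leqnSn _)).
have le1 := le_st i.+1 (leqnSn _); have le2 := le_st i.+2 (leqnn _).
have le_half := le1; rewrite !psum_halves in le_half.
have [s_odd|s_even] := boolP (odd (psum s i.+1)); last by lia.
have [t_odd|t_even] := boolP (odd (psum t i.+1)); first by lia.
have [//|lt_ts] := leqP (psum s i.+1) (psum t i.+1).
have eq_half : psum (halves false s) i.+1 = psum (halves false t) i.+1.
  by rewrite !psum_halves; lia.
have s_ascent := halves_ascent s_sorted s_sympl s_odd.
have t_descent := halves_descent t_sorted t_even.
have eq_step := eq_half; rewrite !(psumS _ i) in eq_step.
rewrite psumS eq_half [X in _ <= X]psumS leq_add2l in le2.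
lia.
Qed.

Lemma dominated_entries n x y : is_bipart n x -> is_bipart n y ->
    (forall i, i <= n.*2.+1 -> psum (entries n x) i <= psum (entries n y) i) ->
  dominated (springer_part n x) (springer_part n y).
Proof.
move=> x_part y_part le_xy j; rewrite !sumn_take.
have [s_part size_s s_sympl eq_s] := springer_partP x_part.
have [t_part size_t t_sympl eq_t] := springer_partP y_part.
rewrite eq_s eq_t in le_xy.
set s := springer_part n x in s_part size_s s_sympl eq_s le_xy *.
set t := springer_part n y in t_part size_t t_sympl eq_t le_xy *.
have [le_jn|lt_nj] := leqP j n.*2; last first.
  rewrite (psum_size (s := t)); last by have := part_size t_part; lia.
  rewrite size_t -size_s -sumn_take -{2}(cat_take_drop j s).
  by rewrite sumn_cat leq_addr.
have [/andP[s_sorted _] /andP[t_sorted _]] := (s_part, t_part).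
apply: psum_le_halves => // k le_k.
have le_kn : k <= n.*2.+1 by apply: leq_trans le_k _.
by have := le_xy k le_kn; rewrite !psum_stair // leq_add2r.
Qed.

Lemma dominated_largest_entry n x y : is_bipart n x -> is_bipart n y ->
    dominated (springer_part n x) (springer_part n y) ->
  nth 0 (entries n x) 0 <= nth 0 (entries n y) 0.
Proof.
move=> x_part y_part /(_ 1); rewrite !sumn_take.
have [_ _ _ ->] := springer_partP x_part.
have [_ _ _ ->] := springer_partP y_part.
rewrite !nth_mkseq // !nth_halves !psum0; lia.
Qed.

(** * Moving boxes to the first part *)

Lemma nth_le_head s i : sorted geq s -> nth 0 s i <= nth 0 s 0.
Proof.
move=> s_sorted; elim: i => // i.
exact: leq_trans (sorted_geq_nthS i s_sorted).
Qed.

Lemma psum_behead s i : sorted geq s -> psum (behead s) i <= psum s i.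
Proof.
by move=> s_sorted; apply: leq_sum => k _; rewrite nth_behead sorted_geq_nthS.
Qed.

Lemma psum_addr s p q : psum s q <= psum s (p + q).
Proof. by rewrite addnC /psum big_split_ord leq_addr. Qed.

(** If the larger of the two heads is left out, then trading the first part
    taken from the other list for it, and each later part for its predecessor,
    does not lower the sum. *)
Lemma merge_psum_ge A B p q : sorted geq A -> sorted geq B ->
  psum A p + psum B q <= psum (merge geq A B) (p + q).
Proof.
have psum_nil i : psum [::] i = 0 by rewrite psum_size.
elim: A B p q => [|a A IHA] B p q A_sorted B_sorted.
  by rewrite psum_nil psum_addr; case: B {B_sorted}.
elim: B p q B_sorted => [|b B IHB] p q B_sorted.
  by rewrite psum_nil addn0 addnC psum_addr.
have A'_sorted := path_sorted A_sorted; have B'_sorted := path_sorted B_sorted.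
rewrite [merge _ _ _]/=; case: ifP => [le_ba|lt_ab].
  case: p => [|p]; last by rewrite addSn !psum_cons -addnA leq_add2l IHA.
  case: q => [|q]; first by rewrite !psum0.
  rewrite psum0 !add0n !psum_cons leq_add //.
  apply: leq_trans (psum_behead q B_sorted) _.
  by have := IHA (b :: B) 0 q A'_sorted B_sorted; rewrite psum0.
case: q => [|q]; last by rewrite addnS !psum_cons addnCA leq_add2l IHB.
case: p => [|p]; first by rewrite !psum0.
rewrite psum0 !addn0 !psum_cons leq_add //; first by move: lt_ab => /=; lia.
apply: leq_trans (psum_behead p A_sorted) _.
by have := IHB p 0 B'_sorted; rewrite psum0 !addn0.
Qed.

Lemma merge_psum_eq A B i : i <= size A + size B ->
  exists p q, [/\ p <= size A, q <= size B, p + q = i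
    & psum (merge geq A B) i = psum A p + psum B q].
Proof.
have psum_nil k : psum [::] k = 0 by rewrite psum_size.
elim: A B i => [|a A IHA] B i le_i.
  by exists 0, i; rewrite psum_nil; case: B le_i.
elim: B i le_i => [|b B IHB] i le_i.
  by exists i, 0; rewrite psum_nil !addn0 in le_i *.
case: i le_i => [|i] le_i; first by exists 0, 0; rewrite !psum0.
rewrite [merge _ _ _]/=; case: ifP => _.
  have [p [q [le_p le_q <- eq_i]]] := IHA (b :: B) i le_i.
  by exists p.+1, q; split; rewrite // !psum_cons eq_i addnA.
have [|p [q [le_p le_q <- eq_i]]] := IHB i; first by move: le_i => /=; lia.
by exists p, q.+1; split; rewrite ?addnS // !psum_cons addnCA -eq_i.
Qed.

(** Since the head of [A] comes first in the merged list, an optimal choice of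
    [p] and [q] with [p = 0] is never forced. *)
Lemma merge_psum_le A B A' B' i :
    0 < size A -> nth 0 B 0 <= nth 0 A 0 -> sorted geq A' -> sorted geq B' ->
    (forall p q, 0 < p <= size A -> q <= size B ->
       psum A p + psum B q <= psum A' p + psum B' q) ->
  i <= size A + size B -> psum (merge geq A B) i <= psum (merge geq A' B') i.
Proof.
case: A => // a A _ le_ba A'_sorted B'_sorted le_psum.
case: i => [|i] le_i; first by rewrite !psum0.
have -> : merge geq (a :: A) B = a :: merge geq A B.
  by case: B le_ba {le_psum le_i} => [|b B] /=; [case: A | move=> ->].
have [//|p [q [le_p le_q <- eq_i]]] := @merge_psum_eq A B i.
rewrite psum_cons eq_i -addSn addnA -(psum_cons a A p).
apply: leq_trans (le_psum p.+1 q le_p le_q) _.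
exact: merge_psum_ge.
Qed.

Lemma rows_sorted n x : sorted geq x.1 -> sorted geq x.2 ->
  sorted geq (rev (usymbol n x).1) /\ sorted geq (rev (usymbol n x).2).
Proof.
move=> x1_sorted x2_sorted; rewrite usymbol_rev1 usymbol_rev2.
split; apply: sorted_mkseq => i _.
  by have := sorted_geq_nthS i x1_sorted; lia.
by have := sorted_geq_nthS i x2_sorted; lia.
Qed.

Lemma entries_merge n x : sorted geq x.1 -> sorted geq x.2 ->
  entries n x = merge geq (rev (usymbol n x).1) (rev (usymbol n x).2).
Proof.
move=> x1_sorted x2_sorted.
have [r1_sorted r2_sorted] := rows_sorted n x1_sorted x2_sorted.
apply: (sorted_eq geq_trans geq_anti (entries_sorted n x)).
  exact: merge_sorted geq_total _ _ r1_sorted r2_sorted.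
by rewrite perm_sort perm_sym perm_merge perm_cat // perm_rev.
Qed.

(** [y] is obtained from [x] by moving boxes to the first part of the first
    partition. *)
Definition shifted (x y : seq nat * seq nat) : Prop :=
  (forall i, nth 0 y.1 i.+1 <= nth 0 x.1 i.+1) /\
  (forall i, nth 0 y.2 i <= nth 0 x.2 i).

Lemma sumn_psum_drop s p : sumn s = psum s p + sumn (drop p s).
Proof. by rewrite -sumn_take -sumn_cat cat_take_drop. Qed.

(** A sum of the largest parts that includes the first one is the size minus the
    parts left out, and those only decrease. *)
Lemma shifted_dominated n x y : is_bipart n x -> is_bipart n y ->
    nth 0 x.2 0 <= nth 0 x.1 0 -> shifted x y ->
  dominated (springer_part n x) (springer_part n y).
Proof.
move=> x_part y_part le_head [le_y1 le_y2].
apply: dominated_entries => // i le_in.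
have /and3P[/andP[x1_sorted _] /andP[x2_sorted _] /eqP size_x] := x_part.
have /and3P[/andP[y1_sorted _] /andP[y2_sorted _] /eqP size_y] := y_part.
rewrite !entries_merge //; have [ry1 ry2] := rows_sorted n y1_sorted y2_sorted.
apply: merge_psum_le => //; rewrite ?size_rev ?size_mkseq //.
- rewrite usymbol_rev1 usymbol_rev2.
  (* For [n = 0] the second row is empty. *)
  have [n0|n_gt0] := posnP n; first by rewrite nth_default // size_mkseq n0.
  rewrite (nth_mkseq _ _ n_gt0) (nth_mkseq _ _ (ltn0Sn n)).
  by clear -le_head n_gt0; lia.
- case=> // p q lt_pn le_qn; rewrite !psum_row1 // !psum_row2 //.
  have le_drop1 : sumn (drop p.+1 y.1) <= sumn (drop p.+1 x.1).
    by apply: leq_sumn => k; rewrite !nth_drop addSn.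
  have le_drop2 : sumn (drop q y.2) <= sumn (drop q x.2).
    by apply: leq_sumn => k; rewrite !nth_drop.
  move: size_x size_y; rewrite (sumn_psum_drop x.1 p.+1) (sumn_psum_drop x.2 q).
  rewrite (sumn_psum_drop y.1 p.+1) (sumn_psum_drop y.2 q).
  by clear -le_drop1 le_drop2; lia.
by clear -le_in; lia.
Qed.

Lemma sumn_behead s : sumn s = nth 0 s 0 + sumn (behead s).
Proof. by case: s. Qed.

(** Domination in both directions gives equal largest entries, hence equal first
    parts: no box has moved. *)
Lemma shifted_eq n x y : is_bipart n x -> is_bipart n y ->
    nth 0 x.2 0 <= nth 0 x.1 0 -> shifted x y ->
    dominated (springer_part n y) (springer_part n x) ->
  y = x.
Proof.
move=> x_part y_part le_head [le_y1 le_y2].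
move=> /(dominated_largest_entry y_part x_part).
have /and3P[x1_part x2_part /eqP size_x] := x_part.
have /and3P[y1_part y2_part /eqP size_y] := y_part.
have [/andP[x1_sorted _] /andP[x2_sorted _]] := (x1_part, x2_part).
have [/andP[y1_sorted _] /andP[y2_sorted _]] := (y1_part, y2_part).
move=> le_entry.
have le_y10 : nth 0 y.1 0 <= nth 0 x.1 0.
  rewrite -(leq_add2r n.*2).
  have y_ge : nth 0 y.1 0 + n.*2 <= nth 0 (entries n y) 0.
    have [ry1 ry2] := rows_sorted n y1_sorted y2_sorted.
    have := merge_psum_ge 1 0 ry1 ry2; rewrite -entries_merge // psum_row1 //.
    by rewrite !psumS !psum0 big_ord1 subn0 /= addn0 !add0n.
  have x_le : nth 0 (entries n x) 0 <= nth 0 x.1 0 + n.*2.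
    have : nth 0 (entries n x) 0 \in (usymbol n x).1 ++ (usymbol n x).2.
      by rewrite -(mem_sort geq) mem_nth // size_entries.
    rewrite mem_cat => /orP[] /mapP[k]; rewrite mem_iota /= add0n => lt_k ->.
      by have := nth_le_head (n - k) x1_sorted; clear -lt_k; lia.
    have := nth_le_head (n - k.+1) x2_sorted; clear -le_head lt_k; lia.
  exact: leq_trans y_ge (leq_trans le_entry x_le).
have le_y1' i : nth 0 (behead y.1) i <= nth 0 (behead x.1) i.
  by rewrite !nth_behead.
have le_sum1 := leq_sumn le_y1'; have le_sum2 := leq_sumn le_y2.
rewrite sumn_behead in size_x; rewrite sumn_behead in size_y.
have [eq_sum1 eq_sum2 eq0] : [/\ sumn (behead x.1) <= sumn (behead y.1),
    sumn x.2 <= sumn y.2 & nth 0 y.1 0 = nth 0 x.1 0].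
  by split; clear -le_sum1 le_sum2 size_x size_y le_y10; lia.
have eq2 : y.2 = x.2 by apply: leq_sumn_eq.
have eq1 : behead y.1 = behead x.1.
  by apply: leq_sumn_eq; rewrite ?is_part_behead.
have eq_y1 : y.1 = x.1.
  apply: part_eq => // -[|i] //; by rewrite -!nth_behead eq1.
by rewrite (surjective_pairing y) eq2 eq_y1 -surjective_pairing.
Qed.

(** * The theorem *)

Theorem theorem8
  (chi : forall n : nat, seq nat * seq nat -> Iirr (weylB n))
  (chi_indexes : indexes_irr chi)
  (k m m' l l' : nat)
  (stable : 2 * m' <= m)
  (hm : k * (k + 1) <= m) (hm' : (k + 1) ^ 2 <= m')
  (hl : l = m - k * (k + 1)) (hl' : l' = m' - (k + 1) ^ 2)
  (xi' eta' : seq nat) (hxi'eta' : is_bipart l' (xi', eta')) :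
  ((exists! x : bipart l, minimal_rep (Theta chi l l' (xi', eta')) x) /\
   (forall x : bipart l, minimal_rep (Theta chi l l' (xi', eta')) x ->
      bpval x = (adjoin_part (l - l') xi', eta')))
  /\
  ((exists! x : bipart l, maximal_rep (Theta chi l l' (xi', eta')) x) /\
   (forall x : bipart l, maximal_rep (Theta chi l l' (xi', eta')) x ->
      bpval x = ((l - l' + nth 0 eta' 0 + nth 0 xi' 0) :: behead xi',
                 behead eta'))).
Proof.
have lt_l : l' < l - l'.
  have sqr : (k + 1) ^ 2 = k * (k + 1) + (k + 1) by rewrite -mulnn mulnDl mul1n.
  rewrite hl hl' sqr; rewrite sqr in hm'; move: hm' hm stable.
  by move: (k * (k + 1)) => s; lia.
have /and3P[/= xi_part eta_part /eqP size_l'] := hxi'eta'.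
have [/andP[xi_sorted _] /andP[eta_sorted _]] := (xi_part, eta_part).
set T := Theta chi l l' (xi', eta').
have memT (x : bipart l) : (x \in T)
    = interlaced xi' (bpval x).1 && interlaced (bpval x).2 eta'.
  exact: mem_Theta.
have xi_le := leq_nth_sumn xi' 0; have eta_le := leq_nth_sumn eta' 0.
have T_head x : x \in T -> nth 0 (bpval x).2 0 <= nth 0 (bpval x).1 0.
  rewrite memT => /andP[/interlacedP le1 /interlacedP le2].
  have /and3P[_ _ /eqP] : is_bipart l (bpval x) by apply: valP.
  rewrite sumn_behead.
  have le_b1 : sumn (behead (bpval x).1) <= sumn xi'.
    by apply: leq_sumn => i; rewrite nth_behead; have /andP[] := le1 i.
  have le_b2 : sumn (bpval x).2 <= sumn eta'.
    by apply: leq_sumn => i; have /andP[] := le2 i.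
  have := leq_nth_sumn (bpval x).2 0.
  by clear -le_b1 le_b2 size_l' lt_l; lia.
have xmin_part : is_bipart l (adjoin_part (l - l') xi', eta').
  rewrite adjoin_largest //; try lia.
  apply/and3P; split=> //=; first by apply: is_part_cons => //; lia.
  by apply/eqP; lia.
pose xmin := BiPart xmin_part.
have xmax_part : is_bipart l
    ((l - l' + nth 0 eta' 0 + nth 0 xi' 0) :: behead xi', behead eta').
  have := sumn_behead xi'; have := sumn_behead eta' => eta_eq xi_eq.
  apply/and3P; split; rewrite /= ?is_part_behead //; last by apply/eqP; lia.
  apply: is_part_cons; [lia | | exact: is_part_behead].
  by rewrite nth_behead; have := sorted_geq_nthS 0 xi_sorted; lia.
pose xmax := BiPart xmax_part.
have xminE : bpval xmin = ((l - l') :: xi', eta').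
  by rewrite /= adjoin_largest //; lia.
have xmin_T : xmin \in T.
  rewrite memT xminE; apply/andP; split; apply/interlacedP => i /=.
    rewrite leqnn; case: i => [|i] /=; first lia.
    exact: sorted_geq_nthS.
  by rewrite leqnn andbT; apply: sorted_geq_nthS.
have xmax_T : xmax \in T.
  rewrite memT; apply/andP; split; apply/interlacedP => i /=.
    rewrite nth_behead sorted_geq_nthS //; case: i => [|i] /=; first by lia.
    by rewrite nth_behead.
  by rewrite nth_behead leqnn sorted_geq_nthS.
have min_shift x : x \in T -> shifted (bpval xmin) (bpval x).
  rewrite memT xminE => /andP[/interlacedP le1 /interlacedP le2].
  by split=> i /=; [have /andP[] := le1 i | have /andP[] := le2 i].
have max_shift x : x \in T -> shifted (bpval x) (bpval xmax).
  rewrite memT => /andP[/interlacedP le1 /interlacedP le2].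
  split=> i /=; rewrite nth_behead.
    by have /andP[] := le1 i.+1.
  by have /andP[] := le2 i.
have xmin_min : minimal_rep T xmin.
  split=> // y y_T; apply: shifted_dominated; rewrite ?(valP xmin) ?(valP y) //.
    exact: T_head.
  exact: min_shift.
have xmax_max : maximal_rep T xmax.
  split=> // y y_T; apply: shifted_dominated; rewrite ?(valP xmax) ?(valP y) //.
    exact: T_head.
  exact: max_shift.
have min_unique y : minimal_rep T y -> xmin = y.
  case=> y_T /(_ _ xmin_T) le_y; apply/esym/val_inj.
  apply: shifted_eq (valP xmin) (valP y) _ _ le_y; first exact: T_head.
  exact: min_shift.
have max_unique y : maximal_rep T y -> xmax = y.
  case=> y_T /(_ _ xmax_T) le_y; apply/val_inj.
  apply: shifted_eq (valP y) (valP xmax) _ _ le_y; first exact: T_head.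
  exact: max_shift.
split; split; [by exists xmin | by move=> x /min_unique <- |
               by exists xmax | by move=> x /max_unique <-].
Qed.
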